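(* Let $X$ be a normed space, $Y$ a Banach space, $W$ a separable subspace of $\mathcal{L}(X,Y)$, $Q$ a bounded subset of $X$ and $E\subseteq \operatorname{Int} Q$. Then there is a residual subset $\mathcal{F}$ of $(\operatorname{Lip}_1(Q,Y),\|\cdot\|_\infty)$ such that for every $f\in\mathcal{F}$ the set $$\mathcal{N}_{f,W}:=\{x\in E\colon \mathcal{D}_f(x)\supseteq \mathbb{B}_W\}$$ is residual in $E$.
   Context: Normed spaces are real. $\mathcal{L}(X,Y)$ is the space of bounded linear operators $X\to Y$ with the operator norm $\|\cdot\|_{\mathrm{op}}$; separability of $W$ refers to this norm, and $\mathbb{B}_W$ is the closed unit ball of $W$. $\operatorname{Int}Q$ is the interior of $Q$. $\operatorname{Lip}_1(Q,Y)$ is the set of mappings $f\colon Q\to Y$ that are Lipschitz with Lipschitz constant at most $1$, with the metric induced by $\|f\|_\infty=\sup_{x\in Q}\|f(x)\|_Y$ (a complete metric space, as $Q$ is bounded and $Y$ is Banach). For $f\colon Q\to Y$ and $x\in\operatorname{Int}Q$, $$\mathcal{D}_f(x):=\Big\{T\in\mathcal{L}(X,Y)\colon \liminf_{r\to0+}\ \sup_{\|u\|_X\le r}\frac{\|f(x+u)-f(x)-Tu\|_Y}{r}=0\Big\}.$$ A subset of a topological space is residual if its complement is of first Baire category (a countable union of nowhere dense sets); ''residual in $E$'' refers to the subspace topology of $E$. *)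

(* Defs.v *)
From HB Require Import structures.
From mathcomp Require Import all_boot all_order all_algebra.
From mathcomp Require Import all_classical all_reals all_analysis.

Set Implicit Arguments.
Unset Strict Implicit.
Unset Printing Implicit Defensive.

Import Order.TTheory GRing.Theory Num.Theory.
Import numFieldNormedType.Exports.

Local Open Scope classical_set_scope.
Local Open Scope ring_scope.

Section BoundedLinear.
Context {R : realType} (X Y : normedModType R).

Definition is_bounded_linear : {pred X -> Y} := fun f =>
  `[< linear f /\ exists M : R, forall x, `|f x| <= M * `|x| >].

Record boundedLinear := BoundedLinear {
  bl_fun :> X -> Y;
  _ : is_bounded_linear bl_fun }.

HB.instance Definition _ := [isSub for bl_fun].
HB.instance Definition _ := [Choice of boundedLinear by <:].

Lemma is_bounded_linear_submod : submod_closed is_bounded_linear.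
Proof.
split=> [|a f g].
  apply/asboolP; split=> [b u v|]; first by rewrite /= scaler0 addr0.
  by exists 0 => x; rewrite normr0 mul0r.
move=> /asboolP[lf [M Mf]] /asboolP[lg [N Ng]]; apply/asboolP.
have E x : (a *: f + g) x = a *: f x + g x by [].
split=> [b u v|].
  rewrite !E lf lg !scalerDr !scalerA [a * b]mulrC -!addrA; congr (_ + _).
  by rewrite addrCA.
exists (`|a| * M + N) => x; rewrite E (le_trans (ler_normD _ _))// normrZ mulrDl.
by rewrite lerD// -mulrA ler_wpM2l.
Qed.

HB.instance Definition _ :=
  GRing.isSubmodClosed.Build R (X -> Y) is_bounded_linear
    is_bounded_linear_submod.
HB.instance Definition _ := [SubChoice_isSubLmodule of boundedLinear by <:].

Implicit Types S T : boundedLinear.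

Lemma bl_linear T : linear T.
Proof. by case: T => f /= /asboolP[]. Qed.

Lemma bl_bounded T : exists M : R, forall x, `|T x| <= M * `|x|.
Proof. by case: T => f /= /asboolP[]. Qed.

Definition opnorm T : R := sup [set `|T x| | x in [set x : X | `|x| <= 1]].

Lemma opnorm_has_sup T : has_sup [set `|T x| | x in [set x : X | `|x| <= 1]].
Proof.
split; first by exists `|T 0|; exists 0 => //=; rewrite normr0.
have [M MT] := bl_bounded T; exists `|M| => _ [x /= x1 <-].
rewrite (le_trans (MT x))// (le_trans (ler_norm _))// normrM normr_id.
by rewrite ler_piMr.
Qed.

Lemma opnorm_ub T x : `|x| <= 1 -> `|T x| <= opnorm T.
Proof. by move=> x1; apply: sup_upper_bound (opnorm_has_sup T) _ _; exists x. Qed.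

Lemma opnorm_ge0 T : 0 <= opnorm T.
Proof. by rewrite (le_trans _ (@opnorm_ub T 0 _)) ?normr0. Qed.

Lemma opnorm_le T (c : R) :
  (forall x, `|x| <= 1 -> `|T x| <= c) -> opnorm T <= c.
Proof.
move=> Tc; apply: ge_sup; first by have [] := opnorm_has_sup T.
by move=> _ [x x1 <-]; exact: Tc.
Qed.

Lemma opnormD S T : opnorm (S + T) <= opnorm S + opnorm T.
Proof.
apply: opnorm_le => x x1; rewrite (le_trans (ler_normD (S x) (T x)))//.
by rewrite lerD// opnorm_ub.
Qed.

Lemma opnormZ (a : R) T : opnorm (a *: T) = `|a| * opnorm T.
Proof.
have le b U : opnorm (b *: U) <= `|b| * opnorm U.
  apply: opnorm_le => x x1; rewrite [leLHS](_ : _ = `|b *: U x|)// normrZ.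
  by rewrite ler_wpM2l// opnorm_ub.
apply/eqP; rewrite eq_le le/=; have [->|a0] := eqVneq a 0.
  by rewrite normr0 mul0r opnorm_ge0.
have := le a^-1 (a *: T); rewrite scalerA mulVf// scale1r => h.
by rewrite (le_trans (ler_wpM2l _ h))// mulrA -normrM divff// normr1 mul1r.
Qed.

Lemma bl0 T : T 0 = 0.
Proof. by have := bl_linear T (-1) 0 0; rewrite !scaleN1r !addNr. Qed.

Lemma opnorm_eq0 T : opnorm T = 0 -> T = 0.
Proof.
move=> T0; apply/val_inj/funext => x; rewrite [RHS](_ : _ = 0 :> Y)//.
have [->|x0] := eqVneq x 0; first exact: bl0.
have T_scal (a : R) : T (a *: x) = a *: T x.
  by have := bl_linear T a x 0; rewrite bl0 !addr0.
have : `|T (`|x|^-1 *: x)| <= 0.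
  by rewrite -T0 opnorm_ub// normrZ normfV normr_id mulVf// normr_eq0.
rewrite T_scal normr_le0 scaler_eq0 invr_eq0 normr_eq0 (negbTE x0) /=.
by move/eqP.
Qed.

Lemma opnormN T : opnorm (- T) = opnorm T.
Proof. by rewrite -scaleN1r opnormZ normrN1 mul1r. Qed.

Lemma opnormMn T n : opnorm (T *+ n) = opnorm T *+ n.
Proof. by rewrite -scaler_nat opnormZ normr_nat mulr_natl. Qed.

HB.instance Definition _ := Num.Zmodule_isNormed.Build R boundedLinear
  opnormD opnorm_eq0 opnormMn opnormN.
HB.instance Definition _ := isPointed.Build boundedLinear 0.
HB.instance Definition _ :=
  PseudoMetric.copy boundedLinear (pseudoMetric_normed boundedLinear).
HB.instance Definition _ :=
  NormedZmod_PseudoMetric_eq.Build R boundedLinear erefl.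
HB.instance Definition _ :=
  PseudoMetricNormedZmod_Lmodule_isNormedModule.Build R boundedLinear opnormZ.

End BoundedLinear.

Section Category.
Context {T : topologicalType}.

Definition nowhere_dense (A : set T) := interior (closure A) = set0.

Definition first_category (A : set T) :=
  exists2 F : (set T)^nat, forall n, nowhere_dense (F n) & A = \bigcup_n F n.

Definition residual (A : set T) := first_category (~` A).

End Category.

(* In the next two definitions a set used as a type is a [set_type], which
   carries the subspace topology. *)
Definition residual_in {T : topologicalType} (E A : set T) :=
  A `<=` E /\ residual [set x : E | A (val x)].

Definition separable {T : topologicalType} (A : set T) :=
  exists2 D : set A, countable D & dense D.

Section Lip1.
Context {R : realType} {X Y : normedModType R} (Q : set X).

Definition supnorm (h : Q -> Y) : R := sup (range (fun x => `|h x|)).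

Lemma supnorm_empty (h : Q -> Y) : ~ nonempty [set: Q] -> supnorm h = 0.
Proof.
move=> Q0; have E : range (fun x : Q => `|h x|) = set0.
  by rewrite -subset0 => y [x _ _]; apply: Q0; exists x.
by rewrite /supnorm E sup0.
Qed.

(* The proof of boundedness is only there to make the supremum metric a metric
   on the type. *)
Record Lip1 (bQ : bounded_set Q) := MkLip1 {
  lip1_fun :> Q -> Y;
  lip1P : forall x y : Q, `|lip1_fun x - lip1_fun y| <= `|val x - val y| }.

Variable bQ : bounded_set Q.

HB.instance Definition _ := gen_eqMixin (Lip1 bQ).
HB.instance Definition _ := gen_choiceMixin (Lip1 bQ).

Implicit Types f g h : Lip1 bQ.

Definition lip1_dist f g : R := supnorm (fun x => f x - g x).

Lemma lip1_bound f g : exists M : R, forall x, `|f x - g x| <= M.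
Proof.
have [[x0]|Q0] := pselect (nonempty [set: Q]); last first.
  by exists 0 => x; exfalso; apply: Q0; exists x.
have [M _ /= QM] := pinfty_ex_gt0 bQ.
exists (`|f x0 - g x0| + (M + M) *+ 2) => x.
have xM : `|val x - val x0| <= M + M.
  rewrite (le_trans (ler_normB _ _))// lerD//; apply: QM; exact: set_valP.
have -> : f x - g x = (f x0 - g x0) + ((f x - f x0) - (g x - g x0)).
  by rewrite [in RHS]addrC addrACA subrK -opprD subrK.
rewrite (le_trans (ler_normD _ _))// lerD// (le_trans (ler_normB _ _))// mulr2n.
by rewrite lerD// (le_trans _ xM)// lip1P.
Qed.

Lemma lip1_dist_ub f g x : `|f x - g x| <= lip1_dist f g.
Proof.
have [M fgM] := lip1_bound f g.
apply: sup_upper_bound; last by exists x.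
by split; [exists `|f x - g x|; exists x|exists M => _ [y _ <-]].
Qed.

Lemma lip1_dist_le f g (c : R) : 0 <= c ->
  (forall x, `|f x - g x| <= c) -> lip1_dist f g <= c.
Proof.
move=> c0 fgc; rewrite /lip1_dist.
have [[x _]|Q0] := pselect (nonempty [set: Q]).
  by apply: ge_sup => [|_ [y _ <-]//]; exists `|f x - g x|; exists x.
by rewrite supnorm_empty.
Qed.

Lemma lip1_dist_ge0 f g : 0 <= lip1_dist f g.
Proof.
have [[x _]|Q0] := pselect (nonempty [set: Q]).
  exact: le_trans (normr_ge0 _) (lip1_dist_ub f g x).
by rewrite /lip1_dist supnorm_empty.
Qed.

Lemma lip1_distxx f : lip1_dist f f = 0.
Proof.
apply/eqP; rewrite eq_le lip1_dist_ge0 andbT lip1_dist_le// => x.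
by rewrite subrr normr0.
Qed.

Lemma lip1_dist_eq0 f g : lip1_dist f g = 0 -> f = g.
Proof.
move=> fg0; have fg : f = g :> (Q -> Y).
  apply/funext => x; apply/eqP; rewrite -subr_eq0 -normr_le0 -fg0.
  exact: lip1_dist_ub.
case: f g fg {fg0} => f fP [g gP] /= fg; rewrite -{}fg in gP *.
by congr MkLip1; exact: Prop_irrelevance.
Qed.

Lemma lip1_dist_sym f g : lip1_dist f g = lip1_dist g f.
Proof.
suff le f' g' : lip1_dist f' g' <= lip1_dist g' f'.
  by apply/eqP; rewrite eq_le !le.
apply: lip1_dist_le => [|x]; first exact: lip1_dist_ge0.
by rewrite distrC lip1_dist_ub.
Qed.

Lemma lip1_dist_triangle g f h :
  lip1_dist f h <= lip1_dist f g + lip1_dist g h.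
Proof.
apply: lip1_dist_le => [|x]; first by rewrite addr_ge0// lip1_dist_ge0.
by rewrite (le_trans (ler_distD (g x) _ _))// lerD// lip1_dist_ub.
Qed.

HB.instance Definition _ := isMetric.Build R (Lip1 bQ)
  lip1_distxx lip1_dist_eq0 lip1_dist_sym lip1_dist_triangle.

End Lip1.
Arguments Lip1 {R X} Y {Q} bQ.

Section MainSets.
Context {R : realType} {X Y : normedModType R} {Q : set X}.

(* [f] is extended by 0 outside [Q]; the lower limit at [x] interior to [Q]
   does not depend on the extension. *)
Definition derivative_ops (f : Q -> Y) (x : X) : set (boundedLinear X Y) :=
  let F := 'valL_ (0 : Y) f in
  [set T : boundedLinear X Y | limf_einf (fun r : R =>
     ereal_sup [set (`|F (x + u) - F x - T u| / r)%:E
               | u in [set u : X | `|u| <= r]]) 0^'+ = 0%E].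

Definition unit_ball (W : set (boundedLinear X Y)) := [set T | W T /\ `|T| <= 1].

Definition differentiability_set (E : set X) (W : set (boundedLinear X Y))
    (f : Q -> Y) : set X :=
  [set x | E x /\ unit_ball W `<=` derivative_ops f x].

End MainSets.

(* Main.v *)
Require Import Defs.
From HB Require Import structures.
From mathcomp Require Import all_boot all_order all_algebra.
From mathcomp Require Import all_classical all_reals all_analysis.
From mathcomp Require Import lra.

Set Implicit Arguments.
Unset Strict Implicit.
Unset Printing Implicit Defensive.

Import Order.TTheory GRing.Theory Num.Theory.
Import numFieldNormedType.Exports.

Local Open Scope classical_set_scope.
Local Open Scope ring_scope.

(** Fix one operator [T] of norm at most 1.  A small change makes a given
    Lipschitz function affine with linear part close to [T] near a single point.
    Multiply the function and [T] by [1 - eta], which leaves some room in the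
    Lipschitz constant; with the results called [g] and [T] again, interpolate
    near [s] between [g] and the affine map [A x = g s + T (x - s)].  Plain
    convexity gives the Lipschitz constant [1 - eta]; the only loss comes from the
    variation of the cutoff [phi], which multiplies [A - g], of size at most
    [2 |x - s|].  A cutoff which is affine in [ln |x - s|] ([log_cutoff]) makes
    this loss at most [eta |x - y|], however small [eta] is.  The new function is
    given by a formula, so that no extension of vector-valued Lipschitz functions
    is involved, and every estimate compares just two points of [Q]
    ([bump_lipschitz]).

    The same change can be made at once at all points of a set [S] whose points
    are at distance at least [delta] from each other ([affine_surgery]).  The
    radius on which the new function [f] is affine is the same for all points of
    [S], so being nearly affine at scale [kappa] near every point of [S]
    survives a small uniform perturbation of [f] and a small displacement of the
    points.  Hence it holds on an open dense set of functions
    ([dense_nearly_affine]).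

    [E] need not be separable, so single points of [E] cannot be treated one
    after the other.  Instead, [E] contains countably many separated sets whose
    union is dense in [E]: for each [n], a maximal [1/n]-separated set of points
    of [E] at distance at least [1/n] from the complement of [Q].  With a
    sequence of operators dense in the unit ball of [W] and the scales [1/k],
    this gives countably many open dense sets of functions.  For [f] in their
    intersection, and for each operator of the sequence and each scale, the set
    of points of [E] where [f] is nearly affine contains a dense open subset of
    [E].  The intersection of these sets is residual in [E].  At each of its
    points [f] is nearly affine at all scales for the operators of the sequence,
    hence for all operators of the unit ball by approximation
    ([nearly_affine_close]), and this makes the lower limits vanish
    ([nearly_affine_derivative]). *)

(** * Residual sets *)

Lemma residual_bigcap_dense (T : topologicalType) (I : countType)
    (G : I -> set T) (A : set T) :
  (forall i, dense (interior (G i))) -> \bigcap_i G i `<=` A -> residual A.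
Proof.
move=> dG GA.
exists (fun n => if unpickle n is Some i then ~` A `&` ~` G i else set0);
  last first.
  apply/seteqP; split=> [x nAx|x [n _]]; last by case: unpickle => // i [].
  apply: contrapT => nx; apply: (nAx); apply: GA => i _.
  apply: contrapT => nGix.
  by apply: nx; exists (pickle i); rewrite ?pickleK.
move=> n; rewrite /nowhere_dense; case: unpickle => [i|]; last first.
  by rewrite closure0 interior0.
apply: contrapT => /eqP/set0P ne.
have [x [xO xG]] := dG i _ ne (open_interior _).
have : closure (~` G i) x.
  exact: closure_subset (@subIsetr _ _ _) _ (interior_subset xO).
by rewrite closure_setC.
Qed.

(** * The logarithmic cutoff *)

(** The function [eta * (ln rho - ln t)], truncated to take its values in
    [[0, 1]], has slope [eta / t] in absolute value.  The bound is stated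
    multiplied by the smaller argument, because the cutoff will multiply a
    function whose size at distance [s] from the centre is of order [s]. *)
Lemma log_cutoff (R : realType) (rho eta : R) : 0 < rho -> 0 < eta ->
  exists (phi : R -> R) (r : R),
  [/\ 0 < r < rho,
      forall t, 0 <= phi t <= 1,
      forall t, t <= r -> phi t = 1,
      forall t, rho <= t -> phi t = 0 &
      forall s t, 0 <= s -> s <= t -> `|phi t - phi s| * s <= eta * (t - s)].
Proof.
move=> rho0 eta0.
have e1 : expR (- eta^-1) < 1 by rewrite expR_lt1 oppr_lt0 invr_gt0.
have e0 := expR_gt0 (- eta^-1).
(* The radius at which [eta * (ln rho - ln r)] reaches 1. *)
pose r := rho * expR (- eta^-1).
have r0 : 0 < r by rewrite mulr_gt0.
have rrho : r < rho by rewrite gtr_pMr.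
have lnr : ln r = ln rho - eta^-1 by rewrite lnM ?posrE// expRK.
pose tau t := Num.min rho (Num.max r t).
have tau_ge t : r <= tau t by rewrite le_min (ltW rrho) le_max lexx.
have tau_le t : tau t <= rho by rewrite ge_min lexx.
have tau_gt0 t : 0 < tau t by exact: lt_le_trans r0 (tau_ge t).
have tau_mono s t : s <= t -> tau s <= tau t.
  by move=> st; rewrite le_min2// le_max2.
exists (fun t => eta * (ln rho - ln (tau t))), r; split.
- by rewrite r0.
- move=> t.
  have : ln r <= ln (tau t) <= ln rho by rewrite !ler_ln ?posrE// tau_ge tau_le.
  rewrite lnr => /andP[l1 l2].
  have h : ln rho - ln (tau t) <= eta^-1 by lra.
  rewrite mulr_ge0 ?(ltW eta0)//; last lra.
  by rewrite (le_trans (ler_wpM2l (ltW eta0) h))// divff// gt_eqF.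
- move=> t tr; rewrite /tau (max_idPl tr) (min_idPr (ltW rrho)) lnr.
  by rewrite opprB addrC subrK divff// gt_eqF.
- move=> t tr; rewrite /tau (max_idPr (le_trans (ltW rrho) tr)) (min_idPl tr).
  by rewrite subrr mulr0.
move=> s t s0 st.
have -> : eta * (ln rho - ln (tau t)) - eta * (ln rho - ln (tau s)) =
    - (eta * (ln (tau t) - ln (tau s))) by lra.
have l0 : 0 <= ln (tau t) - ln (tau s).
  by rewrite subr_ge0 ler_ln ?posrE ?tau_mono.
rewrite normrN ger0_norm ?mulr_ge0 ?(ltW eta0)// -mulrA ler_wpM2l ?(ltW eta0)//.
have [rs|sr] := leP rho s.
  have tauE z : rho <= z -> tau z = rho.
    by move=> rz; rewrite /tau min_l// le_max rz orbT.
  by rewrite !tauE ?(le_trans rs)// subrr mul0r subr_ge0.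
have s_tau : s <= tau s by rewrite le_min (ltW sr) le_max lexx orbT.
have tau_diff : tau t - tau s <= t - s.
  by rewrite /tau /Num.min /Num.max; do ! case: ifPn; rewrite -?leNgt => *; lra.
(* [ln (tau t) - ln (tau s)] is at most [(tau t - tau s) / tau s]. *)
have q0 : 0 <= tau t / tau s - 1.
  by rewrite subr_ge0 ler_pdivlMr// mul1r tau_mono.
have : ln (tau t / tau s) <= tau t / tau s - 1.
  by rewrite -{1}[tau t / tau s](subrK 1) addrC le_ln1Dx//; lra.
rewrite ln_div ?posrE// => /(ler_wpM2r s0) /le_trans; apply.
rewrite (le_trans (ler_wpM2l q0 s_tau))// mulrBl mul1r divfK// gt_eqF//.
Qed.
(** * Making a Lipschitz function affine near separated points *)

Lemma blB (R : realType) (X Y : normedModType R) (T : boundedLinear X Y) u v :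
  T (u - v) = T u - T v.
Proof.
have := bl_linear T (-1) v u; rewrite !scaleN1r => Tvu.
by rewrite [u - v]addrC Tvu addrC.
Qed.

Lemma opnorm_bound (R : realType) (X Y : normedModType R)
    (T : boundedLinear X Y) u : `|T u| <= `|T| * `|u|.
Proof.
have [->|u0] := eqVneq u 0; first by rewrite bl0 !normr0 mulr0.
have nu : 0 < `|u| by rewrite normr_gt0.
have := bl_linear T `|u|^-1 u 0; rewrite bl0 !addr0 => TZ.
have := @opnorm_ub _ _ _ T (`|u|^-1 *: u).
rewrite TZ !normrZ normfV normr_id mulVf ?gt_eqF// => /(_ (lexx _)).
by rewrite ler_pdivrMl// mulrC.
Qed.

(** Here [a] and [b] are the values of the cutoff at two points, [g] and [h]
    those of the function, [p] and [q] those of the affine map.  The factor of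
    [a - b] involves the second point only, which can be chosen as the one nearer
    to the centre. *)
Lemma bump_diff (R : realType) (Y : normedModType R) (a b : R) (g h p q : Y) :
  (g + a *: (p - g)) - (h + b *: (q - h)) =
  (1 - a) *: (g - h) + a *: (p - q) + (a - b) *: (q - h).
Proof.
have e : a *: (p - g) = - (a *: (g - h)) + a *: (p - q) + a *: (q - h).
  rewrite -scalerN -!scalerDr opprB !addrA subrK; congr (_ *: _).
  by rewrite [RHS]addrC !addrA addNr add0r addrC.
by rewrite e !scalerBl scale1r opprD addrACA !addrA.
Qed.

Definition dist_separated {R : realType} {X : normedModType R} (d : R)
    (S : set X) :=
  forall s s', S s -> S s' -> s <> s' -> d <= `|s - s'|.

Section Surgery.
Context {R : realType} {X Y : normedModType R}.
Implicit Types (Q S : set X) (T : boundedLinear X Y) (g : X -> Y).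

(** The convex combination of [g] and of the affine map costs [1 - eta]; the
    difference of the cutoffs is multiplied by at most [2 |y - s|], where [y] is
    the point nearer to [s], and so costs at most the remaining [eta]. *)
Lemma bump_lipschitz Q g T (eta : R) (phi : R -> R) s :
  0 < eta -> Q s ->
  (forall x y, Q x -> Q y -> `|g x - g y| <= (1 - eta) * `|x - y|) ->
  (forall u, `|T u| <= (1 - eta) * `|u|) ->
  (forall t, 0 <= phi t <= 1) ->
  (forall a b, 0 <= a -> a <= b -> `|phi b - phi a| * a <= eta / 2 * (b - a)) ->
  forall x y, Q x -> Q y ->
    `|(g x + phi `|x - s| *: (g s + T (x - s) - g x)) -
      (g y + phi `|y - s| *: (g s + T (y - s) - g y))| <= `|x - y|.
Proof.
move=> eta0 Qs glip Tlip phi01 phislow x y Qx Qy.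
(* [bump_diff] puts the difference of the cutoffs on the second point. *)
wlog yx : x y Qx Qy / `|y - s| <= `|x - s| => [hw|].
  have [h|/ltW h] := leP `|y - s| `|x - s|; first exact: (hw x y).
  by rewrite distrC [leRHS]distrC; exact: (hw y x).
have /andP[p0 p1] := phi01 `|x - s|.
rewrite bump_diff.
have e1 : `|(1 - phi `|x - s|) *: (g x - g y)| <=
    (1 - phi `|x - s|) * ((1 - eta) * `|x - y|).
  by rewrite normrZ ger0_norm ?subr_ge0// ler_wpM2l ?subr_ge0 ?glip.
have e2 : `|phi `|x - s| *: (g s + T (x - s) - (g s + T (y - s)))| <=
    phi `|x - s| * ((1 - eta) * `|x - y|).
  rewrite normrZ ger0_norm// ler_wpM2l// opprD addrACA subrr add0r -blB.
  by rewrite opprB addrA subrK Tlip.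
have e3 : `|g s + T (y - s) - g y| <= 2 * `|y - s|.
  rewrite addrAC (le_trans (ler_normD _ _))//.
  have := glip s y Qs Qy; rewrite [`|s - y|]distrC => h1.
  have := Tlip (y - s); have := mulr_ge0 (ltW eta0) (normr_ge0 (y - s)).
  lra.
have e4 : `|(phi `|x - s| - phi `|y - s|) *: (g s + T (y - s) - g y)| <=
    eta * `|x - y|.
  rewrite normrZ.
  have := ler_wpM2l (normr_ge0 (phi `|x - s| - phi `|y - s|)) e3.
  have := phislow _ _ (normr_ge0 (y - s)) yx.
  have d : `|x - s| - `|y - s| <= `|x - y|.
    by rewrite lerBlDr ler_distD.
  have := ler_wpM2l (ltW eta0) d; lra.
have := ler_normD ((1 - phi `|x - s|) *: (g x - g y) +
  phi `|x - s| *: (g s + T (x - s) - (g s + T (y - s))))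
  ((phi `|x - s| - phi `|y - s|) *: (g s + T (y - s) - g y)).
have := ler_normD ((1 - phi `|x - s|) *: (g x - g y))
  (phi `|x - s| *: (g s + T (x - s) - (g s + T (y - s)))).
lra.
Qed.

(** The bumps live in the disjoint balls of radius [rho] around the points of
    [S].  Inside one ball, [bump_lipschitz] applies.  Two points in different
    balls are at distance at least [delta - 2 rho], while each bump moves [g] by
    at most [2 rho]; the spare factor [eta] absorbs this because
    [8 rho <= eta delta]. *)
Lemma affine_surgery Q S g T (eta delta rho : R) :
  0 < eta -> eta <= 1 -> 0 < rho -> 8 * rho <= eta * delta ->
  S `<=` Q -> dist_separated delta S ->
  (forall x y, Q x -> Q y -> `|g x - g y| <= (1 - eta) * `|x - y|) ->
  (forall u, `|T u| <= (1 - eta) * `|u|) ->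
  exists (f : X -> Y) (r : R),
  [/\ 0 < r < rho,
      forall x y, Q x -> Q y -> `|f x - f y| <= `|x - y|,
      forall x, Q x -> `|f x - g x| <= 2 * rho &
      forall s u, S s -> `|u| <= r -> f (s + u) = f s + T u].
Proof.
move=> eta0 eta1 rho0 rho_small SQ Ssep glip Tlip.
have [phi [r [/andP[r0 rrho] phi01 phi1 phi0 phislow]]] :=
  @log_cutoff R rho (eta / 2) rho0 (divr_gt0 eta0 (ltr0Sn _ 1)).
pose bump s x := g x + phi `|x - s| *: (g s + T (x - s) - g x).
(* The centre of the ball containing [x].  Outside all balls it is [x] itself,
   and then [bump (c x) x] reduces to [g x]. *)
pose c x := xget x [set s | S s /\ `|x - s| < rho].
pose f x := bump (c x) x.
have delta0 : 2 * rho < delta.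
  have : eta * delta <= delta.
    rewrite ler_piMl// -(pmulr_rge0 _ eta0); lra.
  lra.
have fE s x : S s -> `|x - s| < rho -> f x = bump s x.
  move=> Ss xs; rewrite /f; congr bump.
  have [Sc xc] : S (c x) /\ `|x - c x| < rho.
    by apply: (@xgetPex _ x [set s | S s /\ `|x - s| < rho]); exists s.
  apply: contrapT => /(Ssep _ _ Sc Ss).
  have := ler_distD x (c x) s; rewrite [`|c x - x|]distrC; lra.
have fN x : (forall s, S s -> rho <= `|x - s|) -> f x = g x.
  move=> xfar; rewrite /f; have -> : c x = x.
    by rewrite /c xgetPN// => s [/xfar]; case: leP.
  by rewrite /bump subrr bl0 addr0 subrr scaler0 addr0.
have bumpN s x : rho <= `|x - s| -> bump s x = g x.
  by move=> /phi0 p0; rewrite /bump p0 scale0r addr0.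
have bump_lip s x y : S s -> Q x -> Q y -> `|bump s x - bump s y| <= `|x - y|.
  by move=> Ss; apply: (bump_lipschitz (Q := Q) (eta := eta)) => //; exact: SQ.
have near_or_far x : (exists2 s, S s & `|x - s| < rho) \/
    (forall s, S s -> rho <= `|x - s|).
  have [?|nx] := pselect (exists2 s, S s & `|x - s| < rho); [by left|right].
  by move=> s Ss; rewrite leNgt; apply/negP => xs; apply: nx; exists s.
have bump_close s x : S s -> Q x -> `|x - s| < rho ->
    `|bump s x - g x| <= 2 * rho.
  move=> Ss Qx xs; rewrite /bump addrAC subrr add0r normrZ.
  have /andP[p0 p1] := phi01 `|x - s|; rewrite ger0_norm//.
  have : `|g s + T (x - s) - g x| <= 2 * rho.
    rewrite addrAC (le_trans (ler_normD _ _))//.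
    have := glip s x (SQ _ Ss) Qx; rewrite [`|s - x|]distrC.
    have := Tlip (x - s); have := mulr_ge0 (ltW eta0) (normr_ge0 (x - s)).
    lra.
  by apply: le_trans; rewrite ler_piMl.
exists f, r; split.
- by rewrite r0.
- move=> x y Qx Qy.
  have [[s Ss xs]|xfar] := near_or_far x;
    have [[s' Ss' ys]|yfar] := near_or_far y.
  + have [ss'|ss'] := pselect (s = s').
      by rewrite (fE s)// (fE s) ?ss'//; apply: bump_lip.
    rewrite (fE s)// (fE s')//.
    have h1 := bump_close _ _ Ss Qx xs; have h2 := bump_close _ _ Ss' Qy ys.
    have h3 := Ssep _ _ Ss Ss' ss'; have h4 := glip _ _ Qx Qy.
    rewrite distrC in h2.
    have h5 := ler_distD (g x) (bump s x) (bump s' y).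
    have h6 := ler_distD (g y) (g x) (bump s' y).
    have h7 := ler_distD x s s'; have h8 := ler_distD y x s'.
    rewrite [`|s - x|]distrC in h7.
    (* [4 rho <= eta |x - y|], the distance being at least [delta - 2 rho]. *)
    have : eta * (delta - 2 * rho) <= eta * `|x - y| by rewrite ler_pM2l//; lra.
    have : eta * rho <= rho by rewrite ler_piMl// ltW.
    lra.
  + by rewrite (fE s)// fN// -(bumpN s y) ?yfar//; exact: bump_lip.
  + by rewrite (fE s' y)// (fN x)// -(bumpN s' x) ?xfar//; exact: bump_lip.
  + rewrite !fN//; apply: (le_trans (glip _ _ Qx Qy)).
    by have := mulr_ge0 (ltW eta0) (normr_ge0 (x - y)); lra.
- move=> x Qx; have [[s Ss xs]|xfar] := near_or_far x; last first.
    by rewrite fN// subrr normr0; lra.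
  by rewrite (fE s)//; exact: bump_close.
- move=> s u Ss ur.
  have bump_in v : `|v| <= r -> f (s + v) = g s + T v.
    move=> vr; have e : s + v - s = v by rewrite addrAC subrr add0r.
    rewrite (fE s) ?e//; last exact: le_lt_trans rrho.
    by rewrite /bump e phi1// scale1r addrC subrK.
  by rewrite bump_in// -{2}(addr0 s) bump_in ?normr0 ?(ltW r0)// bl0 addr0.
Qed.

End Surgery.

(** * Density of the functions that are nearly affine on a separated set *)

Lemma valL_in (U V : Type) (v : V) (A : set U) (f : A -> V) x (Ax : A x) :
  'valL_v f x = f (SigSub (mem_set Ax)).
Proof. exact: (congr1 (@^~ (SigSub (mem_set Ax))) (valLK v f)). Qed.

Lemma interior_ball (R : realType) (M : pseudoMetricType R) (A : set M) x
    (e : R) : 0 < e -> ball x e `<=` A -> interior A x.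
Proof. by move=> e0 xA; apply/nbhs_ballP; exists e. Qed.

(** One and the same [kappa] bounds the radius and the relative error, so that
    letting [kappa] tend to 0 expresses that the lower limit defining
    [derivative_ops] vanishes. *)
Definition nearly_affine {R : realType} {X Y : normedModType R} (T : X -> Y)
    (kappa : R) (f : X -> Y) : set X :=
  [set x | exists2 r, 0 < r < kappa &
    forall u, `|u| <= r -> `|f (x + u) - f x - T u| <= kappa * r].

Section NearlyAffine.
Context {R : realType} {X Y : normedModType R}.
Implicit Types (Q S : set X) (T : boundedLinear X Y).

Lemma lip1_bounded Q (bQ : bounded_set Q) (f : Lip1 Y bQ) :
  exists2 M : R, 0 < M & forall x, `|f x| <= M.
Proof.
have zlip (x y : Q) : `|(0 : Y) - 0| <= `|val x - val y| by rewrite subrr normr0.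
have [M fM] := lip1_bound f (@MkLip1 _ _ _ _ bQ _ zlip).
exists (`|M| + 1) => [|x]; first by rewrite ltr_wpDl.
by have := fM x; rewrite subr0; have := ler_norm M; lra.
Qed.

(** Surgery on [(1 - eta) g] with the operator [(1 - eta) T]; the shrinking
    moves [g] by at most [eta] times its bound and changes [T] by at most [eta].
    The error is kept at half of the tolerance [kappa], so that the property
    survives perturbations. *)
Lemma surgery_in_Lip1 Q (bQ : bounded_set Q) S T (kappa delta eps : R)
    (g : Lip1 Y bQ) :
  `|T| <= 1 -> 0 < kappa -> 0 < delta -> 0 < eps -> S `<=` Q ->
  dist_separated delta S ->
  exists f : Lip1 Y bQ, lip1_dist g f < eps /\
  exists2 r, 0 < r < Num.min kappa delta & forall s u, S s -> Q (s + u) ->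
    `|u| <= r -> `|'valL_0 f (s + u) - 'valL_0 f s - T u| <= kappa / 2 * r.
Proof.
move=> T1 kappa0 delta0 eps0 SQ Ssep.
have [M M0 gM] := lip1_bounded g.
pose eta : R := Num.min (1 / 2) (Num.min (kappa / 2) (eps / (4 * M))).
have eta0 : 0 < eta by rewrite !lt_min !divr_gt0// mulr_gt0.
have eta1 : eta <= 1 / 2 by rewrite ge_min lexx.
have eta_kappa : eta <= kappa / 2 by rewrite !ge_min lexx orbT.
have eta_M : eta * M <= eps / 4.
  have : eta <= eps / (4 * M) by rewrite !ge_min lexx !orbT.
  by rewrite ler_pdivlMr ?mulr_gt0//; lra.
pose rho : R := Num.min (eta * delta / 8) (Num.min (eps / 8) kappa).
have rho0 : 0 < rho by rewrite !lt_min !divr_gt0// mulr_gt0.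
have rho_delta : 8 * rho <= eta * delta.
  have : rho <= eta * delta / 8 by rewrite ge_min lexx.
  lra.
have rho_eps : rho <= eps / 8 by rewrite !ge_min lexx orbT.
have rho_kappa : rho <= kappa by rewrite !ge_min lexx !orbT.
have rho_delta' : rho <= delta.
  have : eta * delta <= 1 / 2 * delta by rewrite ler_pM2r.
  lra.
pose G x : Y := (1 - eta) *: 'valL_0 g x.
have G_lip x y : Q x -> Q y -> `|G x - G y| <= (1 - eta) * `|x - y|.
  move=> Qx Qy; rewrite -scalerBr normrZ ger0_norm; last lra.
  by rewrite !valL_in ler_wpM2l//; [lra|exact: lip1P].
have T_lip u : `|((1 - eta) *: T : boundedLinear X Y) u| <= (1 - eta) * `|u|.
  rewrite [leLHS](_ : _ = `|(1 - eta) *: T u|)// normrZ ger0_norm; last lra.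
  rewrite ler_wpM2l//; first lra.
  by rewrite (le_trans (opnorm_bound T u))// ler_piMl.
have eta_le1 : eta <= 1 by lra.
have [f [r [/andP[r0 r_rho] f_lip f_G f_aff]]] :=
  affine_surgery eta0 eta_le1 rho0 rho_delta SQ Ssep G_lip T_lip.
have f_lip' (x y : Q) : `|f (val x) - f (val y)| <= `|val x - val y|.
  by apply: f_lip; exact: set_valP.
pose f' := @MkLip1 _ _ _ _ bQ (f \o val) f_lip'.
have fE x : Q x -> 'valL_0 f' x = f x.
  by move=> Qx; rewrite valL_in.
exists f'; split.
  apply: (@le_lt_trans _ _ (eps / 2)); last lra.
  apply: lip1_dist_le => [|x /=]; first lra.
  have Qx : Q (val x) by exact: set_valP.
  have := f_G _ Qx; rewrite /G valL_in.
  have -> : SigSub (mem_set Qx) = x by exact: val_inj.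
  move=> h1.
  have h2 : `|(1 - eta) *: g x - g x| <= eps / 4.
    rewrite scalerBl scale1r addrAC subrr add0r normrN normrZ gtr0_norm//.
    by rewrite (le_trans _ eta_M)// ler_pM2l.
  have := ler_distD ((1 - eta) *: g x) (g x) (f (val x)).
  rewrite distrC in h1; rewrite distrC in h2; lra.
exists r; first by rewrite r0 lt_min !(lt_le_trans r_rho).
move=> s u Ss Qsu ur; rewrite !fE//; last exact: SQ.
rewrite f_aff// [f s + _]addrC addrK.
rewrite [X in `|X|](_ : _ = (1 - eta) *: T u - T u)//.
rewrite scalerBl scale1r addrAC subrr add0r normrN normrZ gtr0_norm//.
rewrite ler_pM ?(ltW eta0)//.
rewrite (le_trans (opnorm_bound T u))// (le_trans _ ur)// ler_piMl//.
Qed.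

(** The radius [r] given by [surgery_in_Lip1] does not depend on [s], so that
    one [sigma] serves as the size of the admissible perturbation of [f] and of
    every point of [S]. *)
Lemma dense_nearly_affine Q (bQ : bounded_set Q) S T (kappa delta : R) :
  `|T| <= 1 -> 0 < kappa -> 0 < delta -> dist_separated delta S ->
  (forall s, S s -> ball s delta `<=` Q) ->
  dense (interior [set f : Lip1 Y bQ |
    S `<=` interior (nearly_affine T kappa ('valL_0 f))]).
Proof.
move=> T1 kappa0 delta0 Ssep SQ O [g Og] oO.
have SQ' : S `<=` Q by move=> s Ss; apply: (SQ s Ss); exact: ballxx.
have /nbhs_ballP[eps /= eps0 gO] : nbhs g O by exact: open_nbhs_nbhs.
have d2 : 0 < delta / 2 by lra.
(* Half of [delta] is left for the displacement of [s], so that [x + u] stays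
   in [Q]. *)
have Ssep2 : dist_separated (delta / 2) S.
  by move=> s s' Ss Ss' ss'; have := Ssep _ _ Ss Ss' ss'; lra.
have [f [gf [r /andP[r0]]]] := surgery_in_Lip1 g T1 kappa0 d2 eps0 SQ' Ssep2.
rewrite lt_min => /andP[r_kappa r_delta] f_aff.
exists f; split; first by apply: gO; rewrite ballEmdist.
(* Passing from [f] and [s] to [f'] and [x] changes each of the two values of the
   function by at most [2 sigma], and [4 sigma <= kappa / 2 * r]. *)
pose sigma := Num.min (kappa * r / 8) (delta / 2).
have sigma0 : 0 < sigma by rewrite lt_min !divr_gt0// mulr_gt0.
have sigma_kr : sigma <= kappa * r / 8 by rewrite ge_min lexx.
have sigma_delta : sigma <= delta / 2 by rewrite ge_min lexx orbT.
apply: (@interior_ball _ _ _ _ sigma) => // f'.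
rewrite ballEmdist /= => ff' s Ss.
apply: (@interior_ball _ _ _ _ sigma) => // x; rewrite -ball_normE /= => sx.
exists r; first by rewrite r0.
move=> u ur.
have in_ball v : `|s - v| < delta -> Q v.
  by move=> sv; apply: (SQ s Ss); rewrite -ball_normE.
have Qx : Q x by apply: in_ball; lra.
have Qs : Q s by exact: SQ'.
have Qxu : Q (x + u).
  apply: in_ball; rewrite opprD addrA (le_lt_trans (ler_normB _ _))//; lra.
have Qsu : Q (s + u).
  by apply: in_ball; rewrite opprD addrA subrr add0r normrN; lra.
have close a b (Qa : Q a) (Qb : Q b) : `|a - b| = `|s - x| ->
    `|'valL_0 f' b - 'valL_0 f a| <= 2 * sigma.
  move=> ab; rewrite distrC !valL_in.
  have := lip1P f (SigSub (mem_set Qa)) (SigSub (mem_set Qb)) => /=.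
  have := lip1_dist_ub f f' (SigSub (mem_set Qb)).
  have := ler_distD (f (SigSub (mem_set Qb))) (f (SigSub (mem_set Qa)))
    (f' (SigSub (mem_set Qb))).
  have ff'_sigma : lip1_dist f f' < sigma := ff'.
  lra.
have h1 := close s x Qs Qx erefl.
have h2 : `|'valL_0 f' (x + u) - 'valL_0 f (s + u)| <= 2 * sigma.
  by apply: close => //; rewrite opprD addrACA subrr addr0.
have h3 := f_aff s u Ss Qsu ur.
have -> : 'valL_0 f' (x + u) - 'valL_0 f' x - T u =
    ('valL_0 f (s + u) - 'valL_0 f s - T u) +
    (('valL_0 f' (x + u) - 'valL_0 f (s + u)) - ('valL_0 f' x - 'valL_0 f s)).
  set a' := 'valL_0 f' (x + u); set b' := 'valL_0 f' x.
  set a := 'valL_0 f (s + u); set b := 'valL_0 f s.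
  rewrite opprB [RHS]addrC !addrA [a' - a + b - b' + a]addrAC.
  by rewrite [a' - a + b + a]addrAC subrK [a' + b - b']addrAC addrK.
have := ler_normD ('valL_0 f (s + u) - 'valL_0 f s - T u)
    (('valL_0 f' (x + u) - 'valL_0 f (s + u)) - ('valL_0 f' x - 'valL_0 f s)).
have := ler_normB ('valL_0 f' (x + u) - 'valL_0 f (s + u))
  ('valL_0 f' x - 'valL_0 f s).
lra.
Qed.

End NearlyAffine.

(** * Countable nets of points and of operators *)

Lemma exists_natSinv_lt (R : realType) (e : R) :
  0 < e -> exists n : nat, n.+1%:R^-1 < e.
Proof.
move=> e0; have [n _ /(_ n (leqnn n))] := near_infty_natSinv_lt (PosNum e0).
by exists n.
Qed.

(** A point at distance at least [d] from a maximal [d]-separated set could be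
    added to it. *)
Lemma maximal_dist_separated (R : realType) (X : normedModType R) (A : set X)
    (d : R) : 0 < d -> exists S : set X, [/\ S `<=` A, dist_separated d S &
  forall x, A x -> exists2 s, S s & `|x - s| < d].
Proof.
move=> d0.
have [|S [[SA Ssep] Smax]] :=
    @Zorn_bigcup X [set S | S `<=` A /\ dist_separated d S].
  move=> F FP Ftot; split=> [x [S FS]|s s' [S FS Ss] [S' FS' Ss']].
    by apply: (FP S FS).1.
  have [SS'|S'S] := Ftot _ _ FS FS'.
    by apply: (FP S' FS').2 => //; exact: SS'.
  by apply: (FP S FS).2 => //; exact: S'S.
exists S; split=> // x Ax; apply: contrapT => xfar.
have {}xfar s : S s -> d <= `|x - s|.
  by move=> Ss; rewrite leNgt; apply/negP => xs; apply: xfar; exists s.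
have nSx : ~ S x by move=> /xfar; rewrite subrr normr0; lra.
apply: (Smax (x |` S)).
  by split=> [y Sy|/(_ x (or_introl erefl))//]; right.
split=> [y [->//|/SA//]|s s' [->|Ss] [->|Ss'] ss' //].
- exact: xfar.
- by rewrite distrC; exact: xfar.
- exact: Ssep.
Qed.

(** The elements of a countable dense subset of [W] that approximate an operator
    of the unit ball may have norm slightly above 1; dividing them by
    [max 1 `|d0 n|] brings them back into the unit ball and moves them by no
    more than their distance to it. *)
Lemma separable_unit_ball_seq (R : realType) (X Y : normedModType R)
    (W : set (boundedLinear X Y)) : separable W ->
  exists d : nat -> boundedLinear X Y, (forall j, `|d j| <= 1) /\
    forall T, unit_ball W T -> forall e : R, 0 < e ->
      exists j, `|T - d j| < e.
Proof.
move=> [D /countable_injP[code code_inj] Ddense].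
pose d0 n : boundedLinear X Y :=
  if pselect (exists t, D t /\ code t = n) is left ex then val (projT1 (cid ex))
  else 0.
have d0E t : D t -> d0 (code t) = val t.
  move=> Dt; rewrite /d0; case: pselect => [ex|]; last by case; exists t.
  case: cid => t' [Dt' tt'] /=; congr val.
  by apply: code_inj; rewrite ?inE.
exists (fun n => (Num.max 1 `|d0 n|)^-1 *: d0 n).
have max_gt0 n : 0 < Num.max 1 `|d0 n| by rewrite lt_max ltr01.
split=> [n|T [WT T1] e e0].
  rewrite normrZ normfV ger0_norm ?(ltW (max_gt0 n))// ler_pdivrMl// mulr1.
  by rewrite le_max lexx orbT.
pose t0 : W := SigSub (mem_set WT).
have [t [t0t Dt]] : (val @^-1` ball T (e / 2) : set W) `&` D !=set0.
  apply: Ddense; first by exists t0 => /=; apply: ballxx; lra.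
  exists (ball T (e / 2)) => //; exact: ball_open.
exists (code t); rewrite d0E//.
have Tt : `|T - val t| < e / 2 by move: t0t; rewrite -ball_normE.
have := ler_distD (val t) T ((Num.max 1 `|val t|)^-1 *: val t).
have : `|val t - (Num.max 1 `|val t|)^-1 *: val t| <= e / 2.
  rewrite -{1}[val t]scale1r -scalerBl normrZ.
  have t1 : `|val t| <= 1 + e / 2.
    have := ler_distD T (val t) 0; rewrite !subr0 [`|val t - T|]distrC; lra.
  have [tle|tgt] := leP `|val t| 1.
    by rewrite invr1 subrr normr0 mul0r; lra.
  have tpos : 0 < `|val t| by lra.
  rewrite ger0_norm; last by rewrite subr_ge0 invf_le1// ltW.
  by rewrite mulrBl mul1r mulVf ?gt_eqF//; lra.
lra.
Qed.

(** * From nearly affine points to the lower limit *)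

Lemma nearly_affine_close (R : realType) (X Y : normedModType R)
    (T T' : boundedLinear X Y) (kappa : R) f x :
  `|T - T'| <= kappa / 2 -> nearly_affine T' (kappa / 2) f x ->
  nearly_affine T kappa f x.
Proof.
move=> TT' [r /andP[r0 rk] fr].
exists r => [|u ur]; first by rewrite r0 (lt_trans rk)//; lra.
have -> : f (x + u) - f x - T u = (f (x + u) - f x - T' u) - (T - T') u.
  by rewrite (_ : (T - T') u = T u - T' u)// opprB addrA subrK.
have := ler_normB (f (x + u) - f x - T' u) ((T - T') u).
have := fr u ur.
have : `|(T - T') u| <= kappa / 2 * r.
  by rewrite (le_trans (opnorm_bound _ _))// ler_pM.
lra.
Qed.

Lemma nearly_affine_derivative (R : realType) (X Y : normedModType R)
    (Q : set X) (f : Q -> Y) (T : boundedLinear X Y) x :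
  (forall kappa : R, 0 < kappa -> nearly_affine T kappa ('valL_0 f) x) ->
  derivative_ops f x T.
Proof.
set F := 'valL_0 f => aff.
pose h (r : R) := ereal_sup [set (`|F (x + u) - F x - T u| / r)%:E
  | u in [set u : X | `|u| <= r]].
suff : limf_einf h 0^'+ = 0%E by [].
rewrite limf_einfE.
have h0 (r : R) : 0 < r -> (0 <= h r)%E.
  move=> r0; apply: le_ereal_sup_tmp.
  exists (`|F (x + 0) - F x - T 0| / r)%:E; last first.
    by rewrite lee_fin divr_ge0 ?(ltW r0).
  by exists 0 => //=; rewrite normr0 ltW.
apply/eqP; rewrite eq_le; apply/andP; split; last first.
  apply: le_ereal_sup_tmp; exists (ereal_inf (h @` [set r : R | 0 < r])).
    by exists [set r : R | 0 < r] => //; exact: nbhs_right_gt.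
  by apply: le_ereal_inf_tmp => _ [r /= r0 <-]; exact: h0.
apply: ge_ereal_sup => _ [V V0 <-]; apply/lee_addgt0Pr => e e0; rewrite add0e.
have /nbhs_ballP[d /= d0 dV] : nbhs (0 : R) [set r : R | 0 < r -> V r] := V0.
have m0 : 0 < Num.min d e by rewrite lt_min d0.
have [r /andP[r0]] := aff _ m0; rewrite lt_min => /andP[rd re] Fr.
apply: ge_ereal_inf; exists (h r).
  by exists r => //; apply: dV => //; rewrite -ball_normE /= sub0r normrN gtr0_norm.
apply: ge_ereal_sup => _ [u /= ur <-]; rewrite lee_fin ler_pdivrMr//.
by rewrite (le_trans (Fr u ur))// ler_pM2r// ge_min lexx orbT.
Qed.

(** * Typical Lipschitz functions *)

Theorem theorem1p1 (R : realType) (X : normedModType R)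
    (Y : completeNormedModType R) (W : set (boundedLinear X Y))
    (W_subspace : submod_closed [in W]) (W_separable : separable W)
    (Q : set X) (Q_bounded : bounded_set Q)
    (E : set X) (EQ : E `<=` interior Q) :
  exists2 F : set (Lip1 Y Q_bounded), residual F &
    forall f, F f -> residual_in E (differentiability_set E W f).
Proof.
have [d [d1 d_dense]] := separable_unit_ball_seq W_separable.
pose mesh n : R := n.+1%:R^-1.
have mesh0 n : 0 < mesh n by rewrite invr_gt0.
(* Points of [E] far enough from the complement of [Q]. *)
pose A n := [set x | E x /\ ball x (mesh n) `<=` Q].
have /choice[S S_net] n := maximal_dist_separated (A n) (mesh0 n).
pose G (i : nat * nat * nat) := [set f : Lip1 Y Q_bounded |
  S i.2 `<=` interior (nearly_affine (d i.1.1) (mesh i.1.2) ('valL_0 f))].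
exists (\bigcap_i G i).
  apply: (@residual_bigcap_dense _ _ G) => // [[[j k] n]] /=.
  have [SA Ssep _] := S_net n.
  by apply: (@dense_nearly_affine _ _ _ _ _ _ _ _ (mesh n)) => // s /SA[].
(* The union of the nets [S n] is dense in [E], and [f] is nearly affine around
   each of their points. *)
move=> f fG; split; first by move=> x [].
apply: (@residual_bigcap_dense _ (nat * nat)%type (fun i => [set x : E |
  nearly_affine (d i.1) (mesh i.2) ('valL_0 f) (val x)])) => [[j k] /=|x xG].
  move=> O [x Ox] [U oU OU].
  have Ux : U (val x) by move: Ox; rewrite -OU.
  have /nbhs_ballP[e1 /= e10 xe1] : nbhs (val x) U by exact: open_nbhs_nbhs.
  have /nbhs_ballP[e2 /= e20 xe2] : nbhs (val x) Q by apply: EQ; exact: set_valP.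
  have e0 : 0 < Num.min e1 e2 by rewrite lt_min e10.
  have [n] := exists_natSinv_lt e0; rewrite lt_min => /andP[ne1 ne2].
  have [SA _ Snet] := S_net n.
  have [|s Ss xs] := Snet (val x).
    split; first exact: set_valP.
    by apply: subset_trans xe2; apply: le_ball; exact: ltW.
  have Es : E s by have [] := SA _ Ss.
  exists (SigSub (mem_set Es)); split.
    rewrite -OU /=; apply: xe1; rewrite -ball_normE /=.
    exact: lt_trans ne1.
  have := fG (j, k, n) I s Ss; rewrite /interior /=.
  exact: (@initial_continuous E X val (SigSub (mem_set Es))).
split; first exact: set_valP.
move=> T WT; apply: nearly_affine_derivative => kappa kappa0.
have kappa2 : 0 < kappa / 2 by lra.
have [j Tj] := d_dense _ WT _ kappa2; have [k kk] := exists_natSinv_lt kappa2.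
apply: (@nearly_affine_close _ _ _ _ (d j)); first exact: ltW.
have [r /andP[r0 rk] fr] := xG (j, k) I.
exists r => [|u ur]; first by rewrite r0 (lt_trans rk).
by rewrite (le_trans (fr u ur))// ler_pM2r// ltW.
Qed.
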